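(* Let $E$ be a non-zero Banach space and let $*,\diamond\in\mathrm{Mltp}(E)$. Suppose that $*$ is unital with unit $e_*$ and that, for a real number $r$ with $0\leq r<1$, we have $|\diamond-*|\leq r\|e_*\|^{-1}$. Then $\diamond$ is also unital. Moreover, letting $s=1+r(1-r)^{-1}$, the unit $e_\diamond$ of $(E,\diamond)$ satisfies $$\|e_\diamond-e_*\|\leq s\,|\diamond-*|\,\|e_*\|^2\leq rs\|e_*\|.$$
   Context: $\mathrm{B}_2(E)$ is the Banach space of bounded bilinear maps $E\times E\to E$ with the operator norm $|\varphi|=\sup\{\|\varphi(x,y)\|:\|x\|\leq1,\|y\|\leq1\}$. $\mathrm{Mltp}(E)\subset\mathrm{B}_2(E)$ is the set of continuous multiplications on $E$, i.e. of those $*\in\mathrm{B}_2(E)$ that are associative as binary operations on $E$ (no bound $|*|\leq1$ is assumed). $*\in\mathrm{Mltp}(E)$ is called unital if the algebra $(E,* )$ has a (two-sided) unit element, denoted $e_*$. *)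

(* Defs.v *)
From HB Require Import structures.
From mathcomp Require Import all_boot all_order all_algebra.
From mathcomp Require Import complex.
From mathcomp Require Import all_classical all_reals all_analysis.

Set Implicit Arguments.
Unset Strict Implicit.
Unset Printing Implicit Defensive.

Import Order.TTheory GRing.Theory Num.Theory.
Import numFieldNormedType.Exports.

Local Open Scope classical_set_scope.
Local Open Scope ring_scope.

Variant scalar_kind := RealScalars | ComplexScalars.

(* Norms take their values in the scalar field K itself. For K = R[i], the    *)
(* relation x <= y means that y - x is a nonnegative real number; hence       *)
(* 0 <= x forces x to be real, and on real numbers this is the usual order.   *)
Definition scalars (R : realType) (k : scalar_kind) : numFieldType :=
  match k with
  | RealScalars => R
  | ComplexScalars => R[i]
  end.

Section BilinearMaps.
Context {K : numFieldType} {E : normedModType K}.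
Implicit Types (m : E -> E -> E) (e : E).

Definition unit_bidisc : set (E * E) :=
  [set p | `|p.1| <= 1 /\ `|p.2| <= 1].

Definition B2 : set (E -> E -> E) :=
  [set m | bilinear_for *:%R *:%R m /\ [bounded m p.1 p.2 | p in unit_bidisc]].

(* For K = R[i] this is a least upper bound in a partial order. An upper      *)
(* bound of a nonempty set of reals is real, so it is the supremum in R.      *)
Definition opnorm m : K :=
  supremum 0 [set `|m p.1 p.2| | p in unit_bidisc].

Definition Mltp : set (E -> E -> E) := [set m | B2 m /\ associative m].

Definition is_unit m e : Prop := left_id e m /\ right_id e m.

Definition unital m : Prop := exists e, is_unit m e.

End BilinearMaps.

Arguments B2 {K} E.
Arguments Mltp {K} E.

(* Main.v *)
Require Import Defs.
From HB Require Import structures.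
From mathcomp Require Import all_boot all_order all_algebra.
From mathcomp Require Import complex.
From mathcomp Require Import all_classical all_reals all_analysis.

Set Implicit Arguments.
Unset Strict Implicit.
Unset Printing Implicit Defensive.

Import Order.TTheory GRing.Theory Num.Theory.
Import numFieldNormedType.Exports.

Local Open Scope classical_set_scope.
Local Open Scope ring_scope.

(** Let [d = diam - star] and let [e] be the unit of [star].  Since
    [diam e x = x + d e x] and [|d e x| <= opnorm d * |e| * |x| <= r * |x|] with
    [r < 1], left translation by [e] in the algebra of [diam] differs from the
    identity by a contraction, so it is onto: the equation [diam e x = y] says
    that [x] is a fixed point of the contraction [x |-> y - d e x]
    ([near_identity_surjective]).  The same holds for right translation by [e].
    An associative operation for which some element has both translations onto
    is unital ([surjective_translations_unital]): a solution [u] of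
    [diam u e = e] is a left unit because every [y] has the form [diam e x], and
    symmetrically there is a right unit.

    For the estimate, let [u] be the unit of [diam].  Then
    [u - e = star e u - diam e u = - d e u], whence
    [|u - e| <= opnorm d * |e| * |u| <= opnorm d * |e| * (|e| + |u - e|)].  Using
    [opnorm d * |e| <= r] on the last summand and solving for [|u - e|] yields
    the bound, as [s = 1 + r / (1 - r)] is just [1 / (1 - r)].

    Norms take values in the scalar field, which for complex scalars is only
    partially ordered.  The order-theoretic facts on which the argument rests
    are transported from the reals: suprema exist, so that [opnorm] really is
    an upper bound ([ler_opnorm]), and powers of [r] become arbitrarily small
    ([scalars_expr_lt]). *)

(** * Real and complex scalars *)

Lemma RRe_ge0 (R : rcfType) (a : R[i]) : 0 <= a -> (complex.Re a)%:C%C = a.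
Proof. by move=> a0; rewrite RRe_real// ger0_real. Qed.

(** In the complex case, an upper bound of a nonempty set of nonnegative scalars
    is itself nonnegative, hence real, so the real supremum of the real parts is
    least among all complex upper bounds. *)
Lemma scalars_has_supremum (R : realType) (k : scalar_kind)
    (A : set (scalars R k)) :
  A !=set0 -> (forall a, A a -> 0 <= a) -> (exists M, ubound A M) ->
  exists S, supremums A S.
Proof.
case: k A => /= A A0 Age0 [M AM].
  exists (sup A); split; first by apply: ub_le_sup; exists M.
  by move=> y Ay; apply: ge_sup.
have ReS : has_sup (@complex.Re R @` A).
  split; first by case: A0 => a Aa; exists (complex.Re a), a.
  exists (complex.Re M) => _ [a Aa <-].
  by have := AM _ Aa; rewrite lecE => /andP[].
exists (sup (@complex.Re R @` A))%:C%C; split.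
  move=> a Aa; rewrite -(RRe_ge0 (Age0 _ Aa)) lecR.
  by apply: sup_upper_bound => //; exists a.
move=> y Ay; case: A0 => a0 Aa0.
have y0 : 0 <= y by apply: le_trans (Age0 _ Aa0) (Ay _ Aa0).
rewrite -(RRe_ge0 y0) lecR; apply: ge_sup; first by exists (complex.Re a0), a0.
by move=> _ [a Aa <-]; have := Ay _ Aa; rewrite lecE => /andP[].
Qed.

Lemma scalars_expr_lt (R : realType) (k : scalar_kind) (r e : scalars R k) :
  0 <= r -> r < 1 -> 0 < e -> exists n, r ^+ n < e.
Proof.
have real_case (a b : R) : 0 <= a -> a < 1 -> 0 < b -> exists n, a ^+ n < b.
  move=> a0 a1 b0.
  have a1' : `|a| < 1 by rewrite ger0_norm.
  have /cvgrPdist_lt /(_ _ b0) [n _ /(_ n (leqnn n))] := cvg_geometric 1 a1'.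
  by rewrite /= mul1r sub0r normrN ger0_norm ?exprn_ge0//; exists n.
case: k r e => /= r e r0 r1 e0; first exact: real_case.
move: r0 r1 e0 (RRe_ge0 r0) (RRe_ge0 (ltW e0)).
move: (complex.Re r) (complex.Re e) => a b r0 r1 e0 ra eb; subst r e.
rewrite ler0c in r0; rewrite -[1]/((1 : R)%:C)%C ltcR in r1.
rewrite -[0]/((0 : R)%:C)%C ltcR in e0.
have [n ab] := real_case a b r0 r1 e0.
by exists n; rewrite -rmorphXn ltcR.
Qed.

(** * Perturbations of the identity *)

(** The Banach fixed point theorem over an arbitrary field of norm values, so
    that it covers the partially ordered complex scalars; the decay of the powers
    of [r] is therefore a hypothesis. *)
Section contraction.
Context {K : numFieldType} {E : completeNormedModType K}.
Variables (g : E -> E) (r : K).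
Hypotheses (r_ge0 : 0 <= r) (r_lt1 : r < 1).
Hypothesis r_small : forall e : K, 0 < e -> exists n, r ^+ n < e.
Hypothesis g_lip : forall x y, `|g x - g y| <= r * `|x - y|.

(** Bounding the distance of two points by their displacements gives the Cauchy
    property of the iterates without summing a geometric series: it suffices that
    the displacement of the iterates tends to zero. *)
Lemma contraction_displacement x y :
  (1 - r) * `|x - y| <= `|x - g x| + `|y - g y|.
Proof.
rewrite mulrBl mul1r lerBlDr.
apply: le_trans (ler_distD (g x) _ _) _; rewrite -addrA lerD2l.
apply: le_trans (ler_distD (g y) _ _) _.
by rewrite [leLHS]addrC (distrC (g y)) lerD2l g_lip.
Qed.

Lemma contraction_iter_displacement n :
  `|iter n g 0 - g (iter n g 0)| <= r ^+ n * `|g 0|.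
Proof.
elim: n => [|n IHn] /=; first by rewrite sub0r normrN expr0 mul1r.
by rewrite (le_trans (g_lip _ _))// exprS -mulrA ler_wpM2l.
Qed.

Lemma contraction_has_fixpoint : exists p, g p = p.
Proof.
have r1_gt0 : 0 < 1 - r by rewrite subr_gt0.
(* The summand 1 allows division when g 0 = 0. *)
have c_gt0 : 0 < `|g 0| + 1 by rewrite ltr_wpDl.
have disp_small e : 0 < e -> exists N, forall n, (N <= n)%N ->
    `|iter n g 0 - g (iter n g 0)| < e.
  move=> e0; have [N rN] := r_small (divr_gt0 e0 c_gt0).
  exists N => n Nn; apply: le_lt_trans (contraction_iter_displacement n) _.
  rewrite ltr_pdivlMr// in rN; apply: le_lt_trans rN.
  rewrite ler_pM ?exprn_ge0 ?lerDl//.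
  by rewrite ler_wiXn2l// ltW.
have /cauchy_cvgP/cvg_ex [/= p yp] : cauchy (iter n g 0 @[n --> \oo]).
  apply: cauchy_exP => e e0.
  have d0 : 0 < (1 - r) * e / 2 by rewrite divr_gt0// mulr_gt0.
  have [N yN] := disp_small _ d0.
  exists (iter N g 0), N => // n /= Nn; rewrite -ball_normE /=.
  rewrite -(ltr_pM2l r1_gt0).
  apply: le_lt_trans (contraction_displacement _ _) _.
  by rewrite [ltRHS]splitr ltrD// yN.
exists p; apply/eqP; rewrite -subr_eq0 -normr_eq0 eq_le normr_ge0 andbT.
(* |p - g p| <= |p - y_n| + |y_n - g y_n| + |g y_n - g p|, for y_n the n-th
   iterate, is at most e / 4 + e / 2 + e / 4 for n large. *)
apply/ler_addgt0Pl => e e0; rewrite addr0.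
have e4 : 0 < e / 2 / 2 by rewrite !divr_gt0.
have /cvgrPdist_lt/(_ _ e4)[N1 _ yp1] := yp.
have [N2 yp2] := disp_small _ (divr_gt0 e0 (@ltr0Sn K 1)).
pose n := maxn N1 N2.
have {yp1} p1 : `|p - iter n g 0| < e / 2 / 2 by apply: yp1; apply: leq_maxl.
have {yp2} p2 := yp2 n (leq_maxr _ _).
rewrite distrC; apply: le_trans (ler_distD (iter n g 0) _ _) _.
rewrite [leRHS]splitr [X in _ <= X + _]splitr -addrA.
apply: lerD; first exact: ltW.
apply: le_trans (ler_distD (g (iter n g 0)) _ _) _.
rewrite [leLHS]addrC lerD ?(ltW p2)//.
apply: le_trans (g_lip _ _) _; rewrite distrC.
apply: le_trans (ltW p1).
by rewrite ler_piMl// ltW.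
Qed.

End contraction.

Lemma near_identity_surjective (K : numFieldType) (E : completeNormedModType K)
    (f : E -> E) (r : K) :
    0 <= r -> r < 1 -> (forall e : K, 0 < e -> exists n, r ^+ n < e) ->
    (forall x y, `|(f x - x) - (f y - y)| <= r * `|x - y|) ->
  forall y, exists x, f x = y.
Proof.
move=> r0 r1 r_small fr y.
have [|x gx] := @contraction_has_fixpoint K E (fun x => y - (f x - x)) r
                  r0 r1 r_small.
  move=> u v /=; rewrite (opprD y) addrACA subrr add0r -opprD normrN.
  exact: fr.
exists x; move: gx => /eqP.
by rewrite opprB addrCA -[X in _ == X]addr0 (inj_eq (addrI x)) subr_eq0 => /eqP.
Qed.

(** * Units of associative operations *)

(** Surjectivity alone suffices: [op u a = a] propagates to [op u y = y] by
    writing [y] as [op a x]. *)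
Lemma surjective_translations_unital (T : Type) (op : T -> T -> T) (a : T) :
    associative op ->
    (forall y, exists x, op a x = y) -> (forall y, exists x, op x a = y) ->
  exists u, left_id u op /\ right_id u op.
Proof.
move=> opA surjl surjr; have [u ua] := surjr a; have [v av] := surjl a.
have lu : left_id u op.
  by move=> y; have [x <-] := surjl y; rewrite opA ua.
have rv : right_id v op.
  by move=> y; have [x <-] := surjr y; rewrite -opA av.
by exists u; split=> // y; rewrite -[u]rv lu.
Qed.

(** * The operator norm *)

Section operator_norm.
Context {R : realType} {k : scalar_kind}.
Local Notation K := (scalars R k).
Context {E : normedModType K}.
Implicit Types m : E -> E -> E.

Lemma B2B m1 m2 : B2 E m1 -> B2 E m2 -> B2 E (fun x y => m1 x y - m2 x y).
Proof.
move=> [[l1 r1] b1] [[l2 r2] b2]; split; first split.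
- move=> u a x y; have /= -> := l1 u a x y; have /= -> := l2 u a x y.
  by rewrite scalerBr opprD addrACA.
- move=> u a x y; have /= -> := r1 u a x y; have /= -> := r2 u a x y.
  by rewrite scalerBr opprD addrACA.
have [M1 M10 bM1] := pinfty_ex_gt0 b1; have [M2 M20 bM2] := pinfty_ex_gt0 b2.
exists (M1 + M2); split; first by rewrite realD ?gtr0_real.
move=> M ltM p pP /=; apply: le_trans (ltW ltM).
by rewrite (le_trans (ler_normB _ _))// lerD// ?[_ <= M1]bM1 ?[_ <= M2]bM2.
Qed.

Lemma ler_opnorm_bidisc m : B2 E m ->
  forall x y, `|x| <= 1 -> `|y| <= 1 -> `|m x y| <= opnorm m.
Proof.
move=> [_ mb] x y x1 y1.
rewrite /opnorm /supremum; set A := (X in supremums X).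
have Axy : A `|m x y| by exists (x, y).
rewrite ifN; last by apply/set0P; exists `|m x y|.
suff /(xgetPex 0)[+ _] : exists S, supremums A S by apply.
apply: scalars_has_supremum; first by exists `|m x y|.
  by move=> _ [p _ <-].
have [M _ bM] := pinfty_ex_gt0 mb.
by exists M => _ [p pP <-]; apply: bM.
Qed.

Lemma ler_opnorm m : B2 E m -> forall x y, `|m x y| <= opnorm m * `|x| * `|y|.
Proof.
move=> mB x y; have [[ml mr] _] := mB.
have mZl a u v : m (a *: u) v = a *: m u v :=
  GRing.scalable_linear (ml v) a u.
have mZr a u v : m u (a *: v) = a *: m u v :=
  GRing.scalable_linear (mr u) a v.
have [->|x0] := eqVneq x 0.
  by rewrite -(scale0r 0) mZl !scale0r !normr0 mulr0 mul0r.
have [->|y0] := eqVneq y 0.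
  by rewrite -(scale0r 0) mZr !scale0r !normr0 mulr0.
have Nx : 0 < `|x| by rewrite normr_gt0.
have Ny : 0 < `|y| by rewrite normr_gt0.
have := @ler_opnorm_bidisc m mB (`|x|^-1 *: x) (`|y|^-1 *: y).
rewrite mZl mZr !normrZ !normfV !normr_id !mulVf ?gt_eqF// lexx.
move=> /(_ isT isT).
by rewrite !ler_pdivrMl// [leRHS]mulrC (mulrC `|x|).
Qed.

End operator_norm.

(** * Perturbations of a unital multiplication *)

Theorem theorem2p2 (R : realType) (k : scalar_kind)
    (E : completeNormedModType (scalars R k)) (E_neq0 : exists x : E, x != 0)
    (star diam : E -> E -> E) (star_mltp : Mltp E star) (diam_mltp : Mltp E diam)
    (e_star : E) (e_starP : is_unit star e_star)
    (r : scalars R k) (r_ge0 : 0 <= r) (r_lt1 : r < 1)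
    (diam_close :
      opnorm (fun x y => diam x y - star x y) <= r * `|e_star|^-1) :
  unital diam /\
  forall e_diam : E, is_unit diam e_diam ->
    let s := 1 + r * (1 - r)^-1 in
    `|e_diam - e_star|
       <= s * opnorm (fun x y => diam x y - star x y) * `|e_star| ^+ 2 /\
    s * opnorm (fun x y => diam x y - star x y) * `|e_star| ^+ 2
       <= r * s * `|e_star|.
Proof.
have [starB _] := star_mltp; have [diamB diamA] := diam_mltp.
have [el er] := e_starP.
have dB := B2B diamB starB.
set d := fun x y => diam x y - star x y in diam_close dB *.
have d_le := ler_opnorm dB.
have e_gt0 : 0 < `|e_star|.
  rewrite normr_gt0; apply/eqP => e0; have [x] := E_neq0.
  have [[sl _] _] := starB.
  have := GRing.scalable_linear (sl x) 0 0.
  by rewrite /= !scale0r -e0 el => ->; rewrite e0 eqxx.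
have de_le : opnorm d * `|e_star| <= r by rewrite -ler_pdivlMr.
have [[dl dr] _] := dB.
have r_small e : 0 < e -> exists n, r ^+ n < e by exact: scalars_expr_lt.
have r1_gt0 : 0 < 1 - r by rewrite subr_gt0.
split.
  apply: (@surjective_translations_unital _ _ e_star) => //.
    apply: (near_identity_surjective r_ge0 r_lt1 r_small) => x y.
    have -> : diam e_star x - x - (diam e_star y - y) = d e_star (x - y).
      by have /= -> := GRing.zmod_morphism_linear (dr e_star) x y; rewrite /d !el.
    by rewrite (le_trans (d_le _ _))// ler_wpM2r.
  apply: (near_identity_surjective r_ge0 r_lt1 r_small (f := diam^~ e_star)).
  move=> x y /=.
  have -> : diam x e_star - x - (diam y e_star - y) = d (x - y) e_star.
    by have /= -> := GRing.zmod_morphism_linear (dl e_star) x y; rewrite /d !er.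
  by rewrite (le_trans (d_le _ _))// mulrAC ler_wpM2r.
move=> u [ul ur] s.
have sE : s = (1 - r)^-1.
  by rewrite /s -[X in X + _](divff (lt0r_neq0 r1_gt0)) -mulrDl subrK mul1r.
have s_ge0 : 0 <= s by rewrite sE invr_ge0 ltW.
have D_ge0 : 0 <= opnorm d * `|e_star|.
  by have := d_le e_star e_star; rewrite -(pmulr_lge0 _ e_gt0); apply: le_trans.
rewrite -mulrA expr2 [opnorm d * _]mulrA.
split; last by rewrite (mulrC r) -[leRHS]mulrA ler_wpM2l// ler_wpM2r.
rewrite sE ler_pdivlMl// mulrBl mul1r lerBlDr.
have -> : u - e_star = - d e_star u by rewrite /d ur el opprB.
rewrite [X in X <= _]normrN; apply: le_trans (d_le _ _) _.
apply: (@le_trans _ _ (opnorm d * `|e_star| * (`|e_star| + `|d e_star u|))).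
  rewrite ler_wpM2l// /d ur el -(lerBlDl) (le_trans (lerB_dist _ _))//.
  by rewrite distrC.
by rewrite mulrDr lerD2l normrN ler_wpM2r.
Qed.
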